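(* Let $n\ge 1$, let $A_n=(a_1,\ldots,a_n)$ be a discount sequence (i.e. $a_i\ge 0$ for all $i$ and $\sum_{i=1}^n a_i>0$), and let $\alpha_2$ be a finite nonnull measure on $\mathbf{R}$ with a finite first moment. Let $M>0$ and let $F,\tilde F$ be probability distributions on $\mathbf{R}$, both with finite means, such that $F\leq_{\rm icx}\tilde F$. Then $$W(MF,\alpha_2;A_n)\le W(M\tilde F,\alpha_2;A_n).$$
   Context: All measures are Borel measures on $\mathbf{R}$; a measure $\alpha$ has a finite first moment (finite mean) if $\int |x|\,d\alpha(x)<\infty$. $\delta_x$ is the point mass at $x$. Dirichlet bandit $(\alpha_1,\alpha_2;A_n)$: at each of $n$ stages one of two arms is selected, sequentially, based on past observations. Observations from arm $i$ are independent draws from $P_i$ given $P_i$, where $P_1,P_2$ are independent random probability measures, $P_i$ having a Dirichlet process prior ${\rm DP}(\alpha_i)$, with $\alpha_i$ a finite nonnull measure with finite first moment. The payoff is $\sum_{i=1}^n a_iZ_i$, where $Z_i$ is the observation at stage $i$. $W(\alpha_1,\alpha_2;A_n)$ denotes the maximum expected payoff over all strategies. After observing $x$ from arm $i$, the posterior of $P_i$ is ${\rm DP}(\alpha_i+\delta_x)$. Equivalently, $W$ is given (for all finite sequences of nonnegative reals) by backward induction: $W=0$ for the empty sequence, and for $n\ge1$, with $A_n^1=(a_2,\ldots,a_n)$, $$W(\alpha_1,\alpha_2;A_n)=\max\{W^1(\alpha_1,\alpha_2;A_n),W^2(\alpha_1,\alpha_2;A_n)\},$$ $$W^1(\alpha_1,\alpha_2;A_n)=a_1\mu_1+E[W(\alpha_1+\delta_X,\alpha_2;A_n^1)\,|\,\alpha_1],$$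 $$W^2(\alpha_1,\alpha_2;A_n)=a_1\mu_2+E[W(\alpha_1,\alpha_2+\delta_Y;A_n^1)\,|\,\alpha_2],$$ where $E[g(X)|\alpha]$ means that $X$ has distribution $\alpha/\alpha(\mathbf{R})$, and $\mu_i=\int x\,d\alpha_i(x)/\alpha_i(\mathbf{R})$ is the expected value of an observation from arm $i$. Increasing convex order: $F\leq_{\rm icx}\tilde F$ means that, for $Z_1\sim F$ and $Z_2\sim\tilde F$, $E\phi(Z_1)\le E\phi(Z_2)$ for every increasing (i.e. nondecreasing) convex function $\phi:\mathbf{R}\to\mathbf{R}$ such that the expectations exist. *)

(* Defs.v *)
From HB Require Import structures.
From mathcomp Require Import all_boot all_order all_algebra.
From mathcomp Require Import all_classical all_reals all_analysis.

Set Implicit Arguments.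
Unset Strict Implicit.
Unset Printing Implicit Defensive.
Import Order.TTheory GRing.Theory Num.Theory.
Import numFieldNormedType.Exports.

Local Open Scope classical_set_scope.
Local Open Scope ring_scope.
Local Open Scope ereal_scope.

Definition finite_first_moment (R : realType)
    (alpha : {measure set (measurableTypeR R) -> \bar R}) : Prop :=
  \int[alpha]_x (`|x|%R)%:E < +oo.

(* Only test functions integrable under both laws are required to be ordered. *)
Definition le_icx (R : realType)
    (F G : probability (measurableTypeR R) R) : Prop :=
  forall phi : R -> R,
    {homo phi : x y / (x <= y)%R} ->
    convex_function (E := R^o) [set: R] phi ->
    F.-integrable [set: R] (EFin \o phi) ->
    G.-integrable [set: R] (EFin \o phi) ->
    'E_F[phi] <= 'E_G[phi].

Definition discount_sequence (R : realType) (n : nat) (A : n.-tuple R) : Prop :=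
  (forall i : 'I_n, 0 <= tnth A i)%R /\ (0 < \sum_(i < n) tnth A i)%R.

(* The law alpha / alpha(R) of an observation from an arm with prior DP(alpha).
   The second argument of mnormalize is a default value, used only when
   alpha(R) is 0 or +oo. *)
Definition predictive (R : realType)
    (alpha : {measure set (measurableTypeR R) -> \bar R}) :
    probability (measurableTypeR R) R :=
  mnormalize alpha (dirac (0%R : measurableTypeR R)).

Definition arm_mean (R : realType)
    (alpha : {measure set (measurableTypeR R) -> \bar R}) : \bar R :=
  \int[predictive alpha]_x x%:E.

(* Parameter of the Dirichlet process posterior after observing x. *)
Definition posterior (R : realType)
    (alpha : {measure set (measurableTypeR R) -> \bar R})
    (x : measurableTypeR R) : {measure set (measurableTypeR R) -> \bar R} :=
  measure_add alpha (dirac x).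

(* Value of the two-armed Dirichlet bandit, by backward induction on the
   discount sequence. The two operands of maxe are the values of pulling arm 1,
   respectively arm 2, first and continuing optimally. Values are taken in
   \bar R so that no expectation needs to be truncated to a real number; they
   are finite when both measures are finite and nonnull with finite first
   moments. *)
Fixpoint W (R : realType)
    (alpha1 alpha2 : {measure set (measurableTypeR R) -> \bar R})
    (A : seq R) {struct A} : \bar R :=
  if A is a :: A' then
    maxe
      (a%:E * arm_mean alpha1 +
         \int[predictive alpha1]_x W (posterior alpha1 x) alpha2 A')
      (a%:E * arm_mean alpha2 +
         \int[predictive alpha2]_y W alpha1 (posterior alpha2 y) A')
  else 0.

(* Main.v *)
Require Import Defs.
From HB Require Import structures.
From mathcomp Require Import all_boot all_order all_algebra.
From mathcomp Require Import all_classical all_reals all_analysis.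
From mathcomp Require Import measurable_realfun ring.

Set Implicit Arguments.
Unset Strict Implicit.
Unset Printing Implicit Defensive.
Import Order.TTheory GRing.Theory Num.Theory.
Import numFieldNormedType.Exports.

Local Open Scope classical_set_scope.
Local Open Scope ring_scope.
Local Open Scope ereal_scope.

(** Write V(mu) for the value of the bandit as a function of the parameter mu
    of one arm. The theorem asserts that V is monotone in the increasing convex
    order among measures of equal mass ([value_icx]). By induction on the
    number of stages, suppose this is known for the continuation value V'. If
    mu is replaced by a larger mu' and mu' is the arm pulled, the immediate
    payoff is the mean, which increases. The expected continuation value
    changes from the integral of V'(mu + delta_x) against mu to the integral of
    V'(mu' + delta_x) against mu'. By induction V'(mu + delta_x) is at most
    V'(mu' + delta_x), so it is enough that x |-> V'(mu' + delta_x) is a test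
    function of the order, that is, nondecreasing and convex. It is
    nondecreasing because delta_x grows with x.

    Convexity is the heart of the matter. For weights a + b = 1, the measure
    mu + delta_{ax+by} lies below mu + a delta_x + b delta_y, so it remains to
    compare V'(mu + a delta_x + b delta_y) with a V'(mu + delta_x) +
    b V'(mu + delta_y). Convexity of V' along arbitrary mixtures of parameters
    is false, but it does hold when a single atom is split into two
    ([value_split]):

      (p + q) V(mu + p delta_x + q delta_y)
        <= p V(mu + (p + q) delta_x) + q V(mu + (p + q) delta_y).

    This too is proved by induction. When the arm itself is pulled, the next
    observation comes from mu, x or y. Applying the induction hypothesis after
    each of these observations leaves a gap, which is closed by

      V'(mu + c delta_y + delta_x) + V'(mu + c delta_x + delta_y)
        <= V'(mu + (c+1) delta_x) + V'(mu + (c+1) delta_y)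

    with c = p + q ([updated_value_swap]). This is the sum of two instances of
    the splitting inequality itself, with weights c and 1. Arbitrary weights,
    rather than weights of total mass 1, are what make the induction close.

    A third statement is carried along to make all integrals meaningful: the
    value is bounded by a multiple of the sum of the absolute first moments of
    the two predictive laws ([value_bounded]). The absolute moment is a
    martingale under posterior updating, so the bound reproduces itself.
    Monotonicity gives measurability of x |-> V(mu + delta_x), and the bound
    gives its integrability. The induction is run on a real-valued version of
    the value, shown at the end to agree with the extended-real one
    ([W_value]). *)

Section Bandit.
Context {R : realType}.
Local Notation T := (measurableTypeR R).
Local Notation mea := {measure set T -> \bar R}.
Implicit Types (mu nu rho : mea) (f g h : R -> R) (x y z : R).
Implicit Types (p q : {nonneg R}).
Local Open Scope ring_scope.

(** * Measures with an added atom *)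

(** A name for this sum keeps its structure coercions out of the goals and lets
    iterated updates be compared by rewriting. *)
Definition add_atom mu p x : mea := measure_add mu (mscale p (dirac (x : T))).

Lemma add_atomE mu p x (S : set T) :
  add_atom mu p x S = (mu S + p%:num%:E * dirac (x : T) S)%E.
Proof. exact: measure_addE. Qed.

Lemma posteriorE mu x : posterior mu x = add_atom mu 1%:nng x.
Proof.
apply: eq_measure; apply/funext => S.
by rewrite add_atomE mul1e; exact: measure_addE.
Qed.

Lemma add_atomD mu p q x :
  add_atom (add_atom mu p x) q x = add_atom mu (p%:num + q%:num)%:nng x.
Proof.
apply: eq_measure; apply/funext => S.
by rewrite !add_atomE -addeA -ge0_muleDl// lee_fin.
Qed.

Lemma posterior_add_atom mu p x z :
  posterior (add_atom mu p x) z = add_atom (posterior mu z) p x.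
Proof.
by apply: eq_measure; apply/funext => S; rewrite !posteriorE !add_atomE addeAC.
Qed.

(** * Integrable functions *)

Definition L1 mu f := mu.-integrable [set: T] (EFin \o f).

Lemma L1_measurable mu f : L1 mu f -> measurable_fun [set: T] (f : T -> R).
Proof. by move=> /measurable_int /measurable_EFinP. Qed.

Lemma L1_scale mu p f : L1 mu f -> L1 (mscale p mu) f.
Proof.
move=> /integrableP[mf h]; apply/integrableP; split=> //.
rewrite ge0_integral_mscale//; last exact: measurableT_comp.
by rewrite lte_mul_pinfty.
Qed.

Lemma L1_scale_gt0 mu p f : 0 < p%:num -> L1 (mscale p mu) f -> L1 mu f.
Proof.
move=> p0 /integrableP[mf h]; apply/integrableP; split=> //.
move: h; rewrite ge0_integral_mscale//; last exact: measurableT_comp.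
by rewrite !ltey; apply: contra => /eqP ->; rewrite gt0_muley.
Qed.

Lemma L1_atom p x f : measurable_fun [set: T] (f : T -> R) ->
  L1 (mscale p (dirac (x : T))) f.
Proof.
move=> mf; apply: L1_scale; apply/integrableP; split.
  exact/measurable_EFinP.
rewrite integral_dirac//; last first.
  by apply: measurableT_comp => //; exact/measurable_EFinP.
by rewrite diracT mul1e ltry.
Qed.

Lemma L1_add_atom mu p x f : L1 (add_atom mu p x) f <-> L1 mu f.
Proof.
have E (mf : measurable_fun [set: T] (f : T -> R)) :
    (\int[add_atom mu p x]_z `|(f z)%:E| =
     \int[mu]_z `|(f z)%:E| +
     \int[mscale p (dirac (x : T))]_z `|(f z)%:E|)%E.
  rewrite ge0_integral_measure_add//.
  by apply: measurableT_comp => //; exact/measurable_EFinP.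
split=> h; have mf := L1_measurable h; apply/integrableP.
  split; first exact/measurable_EFinP.
  move/integrableP : h => [_]; rewrite E//; apply: le_lt_trans.
  by rewrite leeDl// integral_ge0.
split; first exact/measurable_EFinP.
move/integrableP : h => [_ h]; rewrite E// lte_add_pinfty//.
by have /integrableP[] := L1_atom p x mf.
Qed.

(** The positive and negative parts are scaled separately; integrability is
    what makes their difference well defined. *)
Lemma integral_scale mu p f : L1 mu f ->
  (\int[mscale p mu]_x (f x)%:E = p%:num%:E * \int[mu]_x (f x)%:E)%E.
Proof.
move=> h; have mf := measurable_int _ h.
have nf := integrable_neg_fin_num measurableT h.
rewrite integralE [in RHS]integralE.
rewrite !ge0_integral_mscale//; try exact: measurable_funepos;
  try exact: measurable_funeneg.
by rewrite [RHS]muleBr// fin_num_adde_defl// fin_numN.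
Qed.

Lemma Rintegral_scale mu p f : L1 mu f ->
  \int[mscale p mu]_x f x = p%:num * \int[mu]_x f x.
Proof.
move=> h; rewrite /Rintegral integral_scale// fineM//.
exact: integrable_fin_num.
Qed.

Lemma Rintegral_add_atom mu p x f : L1 mu f ->
  \int[add_atom mu p x]_z f z = \int[mu]_z f z + p%:num * f x.
Proof.
move=> h; have mf := L1_measurable h; have hx := L1_atom p x mf.
have -> : p%:num * f x = \int[mscale p (dirac (x : T))]_z f z.
  rewrite Rintegral_scale; last first.
    (* An atom of weight 1, since p itself may be 0. *)
    exact: (L1_scale_gt0 (p := 1%:nng) ltr01 (L1_atom _ _ mf)).
  rewrite /Rintegral integral_dirac//; last exact/measurable_EFinP.
  by rewrite diracT mul1e.
rewrite /Rintegral (integral_measure_add measurableT h hx) fineD//.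
- exact: (integrable_fin_num measurableT h).
- exact: (integrable_fin_num measurableT hx).
Qed.

Lemma L1_lin mu f g (u v : R) : L1 mu f -> L1 mu g ->
  L1 mu (fun x => u * f x + v * g x).
Proof.
move=> hf hg; rewrite /L1.
have := integrableD measurableT (integrableZl measurableT u hf)
  (integrableZl measurableT v hg).
by apply: eq_integrable.
Qed.

Lemma Rintegral_lin mu f g (u v : R) : L1 mu f -> L1 mu g ->
  \int[mu]_x (u * f x + v * g x) = u * \int[mu]_x f x + v * \int[mu]_x g x.
Proof.
move=> hf hg.
rewrite RintegralD//; first by rewrite !RintegralZl.
- exact: (integrableZl measurableT u hf).
- exact: (integrableZl measurableT v hg).
Qed.

Lemma Rintegral_le_lin mu f g h (c u v : R) : L1 mu f -> L1 mu g -> L1 mu h ->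
  (forall x, c * f x <= u * g x + v * h x) ->
  c * \int[mu]_x f x <= u * \int[mu]_x g x + v * \int[mu]_x h x.
Proof.
move=> hf hg hh le.
rewrite -Rintegral_lin// -RintegralZl//.
apply: le_Rintegral => //; last exact: L1_lin.
exact: (integrableZl measurableT c hf).
Qed.

(** * Admissible parameters *)

(** The parameters for which a Dirichlet process prior has an observation with
    finite mean. *)
Definition admissible mu :=
  [/\ (0 < mu [set: T])%E, (mu [set: T] < +oo)%E & finite_first_moment mu].

Definition mass mu : R := fine (mu [set: T]).

Lemma mass_gt0 mu : admissible mu -> 0 < mass mu.
Proof. by case=> h1 h2 _; rewrite /mass fine_gt0// h1. Qed.

Lemma massE mu : admissible mu -> mu [set: T] = (mass mu)%:E.
Proof. by case=> h1 h2 _; rewrite /mass fineK// ge0_fin_numE// ltW. Qed.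

Lemma L1_cst mu (u : R) : admissible mu -> L1 mu (fun=> u).
Proof.
case=> _ h _; apply/integrableP; split; first exact: measurable_cst.
by rewrite integral_cst// lte_mul_pinfty.
Qed.

Lemma L1_norm_moment mu : L1 mu (fun x => `|x|) <-> finite_first_moment mu.
Proof.
have E : (\int[mu]_x `|(`|x|)%:E| = \int[mu]_x (`|x|)%:E)%E.
  by apply: eq_integral => x _ /=; rewrite normr_id.
split=> [/integrableP[_]|h]; first by rewrite E.
apply/integrableP; split; last by rewrite E.
by apply/measurable_EFinP; exact: measurableT_comp.
Qed.

Lemma L1_norm mu : admissible mu -> L1 mu (fun x => `|x|).
Proof. by case=> _ _ /L1_norm_moment. Qed.

Lemma L1_dominated mu f (u v : R) : admissible mu ->
  measurable_fun [set: T] (f : T -> R) ->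
  (forall x, `|f x| <= u + v * `|x|) -> L1 mu f.
Proof.
move=> amu mf le.
have h : L1 mu (fun x => 1 * u + v * `|x|).
  by apply: L1_lin; [exact: L1_cst|exact: L1_norm].
apply: (le_integrable measurableT _ _ h) => //; first exact/measurable_EFinP.
by move=> x _; rewrite /= lee_fin mul1r (le_trans (le x))// ler_norm.
Qed.

Lemma L1_id mu : admissible mu -> L1 mu id.
Proof.
move=> amu; apply: (@L1_dominated _ _ 0 1) => // x.
by rewrite add0r mul1r.
Qed.

Lemma admissible_add_atom mu p x :
  admissible mu -> admissible (add_atom mu p x).
Proof.
move=> amu; have [h1 h2 h3] := amu; split.
- by rewrite add_atomE diracT mule1 (lt_le_trans h1)// leeDl// lee_fin.
- by rewrite add_atomE diracT mule1 lte_add_pinfty// ltry.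
- by apply/L1_norm_moment; apply/L1_add_atom; exact: L1_norm.
Qed.

Lemma admissible_posterior mu x : admissible mu -> admissible (posterior mu x).
Proof. by rewrite posteriorE; exact: admissible_add_atom. Qed.

Lemma admissible_scale (F : probability T R) p : 0 < p%:num ->
  finite_first_moment F -> admissible (mscale p F).
Proof.
move=> p0 mF.
have FT : (mscale p F : mea) [set: T] = p%:num%:E.
  by rewrite -[RHS]mule1 -(probability_setT F).
split; rewrite ?FT ?lte_fin ?ltry//.
by apply/L1_norm_moment; apply: L1_scale; exact/L1_norm_moment.
Qed.

Lemma mass_add_atom mu p x : admissible mu ->
  mass (add_atom mu p x) = mass mu + p%:num.
Proof. by move=> amu; rewrite /mass add_atomE (massE amu) diracT mule1. Qed.

(** * Predictive expectations *)

(** Division of the integral by the mass, instead of integration against the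
    normalized measure, makes the effect of an added atom explicit. *)
Definition predictive_mean mu f : R := (\int[mu]_x f x) / mass mu.

Lemma integral_predictive mu f : admissible mu -> L1 mu f ->
  (\int[predictive mu]_x (f x)%:E)%E = (predictive_mean mu f)%:E.
Proof.
move=> amu hf; have m0 := mass_gt0 amu.
have iv0 : 0 <= (mass mu)^-1 by rewrite invr_ge0 ltW.
rewrite (eq_measure_integral (mscale (NngNum iv0) mu)); last first.
  move=> S _ _.
  rewrite /predictive/= /mnormalize (massE amu).
  by rewrite eqe (gt_eqF m0)/= /mscale/= muleC.
rewrite integral_scale// /predictive_mean mulrC EFinM /=; congr (_ * _)%E.
by rewrite /Rintegral fineK//; exact: (integrable_fin_num measurableT hf).
Qed.

Lemma predictive_mean_lin mu f g (u v : R) : L1 mu f -> L1 mu g ->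
  predictive_mean mu (fun x => u * f x + v * g x) =
  u * predictive_mean mu f + v * predictive_mean mu g.
Proof.
by move=> hf hg; rewrite /predictive_mean Rintegral_lin// mulrDl !mulrA.
Qed.

Lemma predictive_mean_cst mu (u : R) : admissible mu ->
  predictive_mean mu (fun=> u) = u.
Proof.
move=> amu; have m0 := mass_gt0 amu.
by rewrite /predictive_mean Rintegral_cst// mulfK// gt_eqF.
Qed.

Lemma predictive_mean_le_lin mu f g h (c u v : R) : admissible mu ->
  L1 mu f -> L1 mu g -> L1 mu h ->
  (forall x, c * f x <= u * g x + v * h x) ->
  c * predictive_mean mu f <=
  u * predictive_mean mu g + v * predictive_mean mu h.
Proof.
move=> amu hf hg hh le; rewrite /predictive_mean !mulrA -mulrDl.
by rewrite ler_pM2r ?invr_gt0 ?mass_gt0// Rintegral_le_lin.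
Qed.

Lemma predictive_mean_le mu f g : admissible mu -> L1 mu f -> L1 mu g ->
  (forall x, f x <= g x) -> predictive_mean mu f <= predictive_mean mu g.
Proof.
move=> amu hf hg le; rewrite /predictive_mean.
by rewrite ler_pM2r ?invr_gt0 ?mass_gt0// le_Rintegral.
Qed.

Lemma le_norm_predictive_mean mu f : admissible mu -> L1 mu f ->
  `|predictive_mean mu f| <= predictive_mean mu (fun x => `|f x|).
Proof.
move=> amu hf; have m0 := mass_gt0 amu.
rewrite /predictive_mean normrM [X in _ * X]gtr0_norm ?invr_gt0//.
by rewrite ler_pM2r ?invr_gt0// le_normr_Rintegral.
Qed.

Definition abs_mean mu := predictive_mean mu (fun x => `|x|).

Lemma abs_mean_ge0 mu : admissible mu -> 0 <= abs_mean mu.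
Proof.
move=> amu; rewrite /abs_mean /predictive_mean divr_ge0//.
  exact: Rintegral_ge0.
by rewrite ltW// mass_gt0.
Qed.

(** Averaging the right-hand side over x drawn from the predictive law of mu
    gives back the absolute mean of mu: the martingale property behind
    [value_bounded]. *)
Lemma abs_mean_posterior mu x : admissible mu ->
  abs_mean (posterior mu x) =
  (mass mu * abs_mean mu + `|x|) / (mass mu + 1).
Proof.
move=> amu; have m0 := mass_gt0 amu; have hn := L1_norm amu.
rewrite /abs_mean /predictive_mean posteriorE mass_add_atom//.
by rewrite Rintegral_add_atom// mul1r mulrCA divff ?mulr1// gt_eqF.
Qed.

(** * The increasing convex order *)

Definition convex_real f := forall a b x y : R, 0 <= a -> 0 <= b -> a + b = 1 ->
  f (a * x + b * y) <= a * f x + b * f y.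

(** The increasing convex order for measures that need not be probabilities.
    The constants 1 and -1 are test functions, so it forces equal masses. *)
Definition icx mu nu := forall f, {homo f : x y / x <= y} -> convex_real f ->
  L1 mu f -> L1 nu f -> \int[mu]_x f x <= \int[nu]_x f x.

Lemma icx_mass mu nu : admissible mu -> admissible nu -> icx mu nu ->
  mass mu = mass nu.
Proof.
move=> amu anu h; apply/eqP; rewrite eq_le.
have h1 := h (fun=> 1) (fun _ _ _ => lexx 1).
have h2 := h (fun=> -1) (fun _ _ _ => lexx (-1)).
rewrite !Rintegral_cst// !mul1r in h1.
rewrite !Rintegral_cst// !mulN1r lerN2 in h2.
rewrite h1 ?h2//; try exact: L1_cst.
- by move=> a b _ _ a0 b0 ab; rewrite !mulrN1 -opprD ab.
- by move=> a b _ _ a0 b0 ab; rewrite !mulr1 ab.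
Qed.

Lemma icx_posterior mu nu x : icx mu nu ->
  icx (posterior mu x) (posterior nu x).
Proof.
rewrite !posteriorE => h f nd cv /L1_add_atom h1 /L1_add_atom h2.
by rewrite !Rintegral_add_atom// lerD2r h.
Qed.

Lemma icx_posterior_homo mu x y : x <= y ->
  icx (posterior mu x) (posterior mu y).
Proof.
rewrite !posteriorE => xy f nd cv /L1_add_atom h1 /L1_add_atom h2.
by rewrite !Rintegral_add_atom// lerD2l !mul1r nd.
Qed.

(** The two sides of the convexity inequality of a test function are its
    integrals against the measures added to mu. *)
Lemma icx_posterior_split mu p q x y : p%:num + q%:num = 1 ->
  icx (posterior mu (p%:num * x + q%:num * y))
      (add_atom (add_atom mu p x) q y).
Proof.
rewrite !posteriorE => pq f nd cv /L1_add_atom h1 /L1_add_atom h2'.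
have h2 : L1 mu f by move: h2' => /L1_add_atom.
by rewrite !Rintegral_add_atom// -addrA lerD2l mul1r cv.
Qed.

Lemma le_icx_scale (F F' : probability T R) p :
  0 < p%:num -> le_icx F F' -> icx (mscale p F) (mscale p F').
Proof.
move=> p0 h f nd cv h1 h2.
have {}h1 := L1_scale_gt0 p0 h1; have {}h2 := L1_scale_gt0 p0 h2.
rewrite !Rintegral_scale// ler_pM2l//.
have := h f nd _ h1 h2; rewrite unlock => h'.
rewrite /Rintegral fine_le//.
- exact: (integrable_fin_num measurableT h1).
- exact: (integrable_fin_num measurableT h2).
apply: h' => t x y _ _.
rewrite !convRE; apply: cv => //.
  by rewrite subr_ge0 le1.
by rewrite addrC subrK.
Qed.

(** * The real-valued bandit *)

Local Notation mean := predictive_mean.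

(** The real-valued counterpart of [W]: the recursion is the same, with
    [predictive_mean] for the expectations, so that inequalities need no case
    analysis on infinite values. *)
Fixpoint value mu nu (A : seq R) : R :=
  if A is a :: A' then
    Num.max
      (a * mean mu id + mean mu (fun x => value (posterior mu x) nu A'))
      (a * mean nu id + mean nu (fun y => value mu (posterior nu y) A'))
  else 0.

(** Reduces every statement about the second arm to the first. *)
Lemma value_sym A mu nu : value mu nu A = value nu mu A.
Proof.
elim: A mu nu => //= a A IH mu nu; rewrite maxC.
congr (Num.max (_ + mean _ _) (_ + mean _ _)); apply/funext => z; exact: IH.
Qed.

Definition updated_value A mu nu x := value (posterior mu x) nu A.

Definition pull_value a A mu nu :=
  a * mean mu id + mean mu (updated_value A mu nu).

Lemma value_cons a A mu nu :
  value mu nu (a :: A) = Num.max (pull_value a A mu nu) (pull_value a A nu mu).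
Proof.
rewrite /=; congr (Num.max _ (_ + mean _ _)).
by apply/funext => y; rewrite /updated_value value_sym.
Qed.

Definition value_bounded A := forall mu nu, admissible mu -> admissible nu ->
  `|value mu nu A| <= (\sum_(a <- A) `|a|) * (abs_mean mu + abs_mean nu).

Definition value_icx A := forall mu mu' nu,
  admissible mu -> admissible mu' -> admissible nu -> icx mu mu' ->
  value mu nu A <= value mu' nu A.

(** Convexity in the position of an atom, for the three parameters that
    distribute the mass p + q over x and y. *)
Definition value_split A := forall mu nu p q x y,
  admissible mu -> admissible nu ->
  (p%:num + q%:num) * value (add_atom (add_atom mu p x) q y) nu A <=
  p%:num * value (add_atom mu (p%:num + q%:num)%:nng x) nu A +
  q%:num * value (add_atom mu (p%:num + q%:num)%:nng y) nu A.

(** * Consequences for one more stage *)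

Section Updated_value.
Variable A : seq R.
Hypotheses (bd : value_bounded A) (mono : value_icx A) (sp : value_split A).

Lemma updated_value_homo mu nu : admissible mu -> admissible nu ->
  {homo updated_value A mu nu : x y / x <= y}.
Proof.
move=> amu anu x y xy.
by apply: mono; [exact: admissible_posterior..| |exact: icx_posterior_homo].
Qed.

(** First replace the atom at a x + b y by atoms at x and y, which only
    increases the value, then use [value_split] with weights of sum 1. *)
Lemma updated_value_convex mu nu : admissible mu -> admissible nu ->
  convex_real (updated_value A mu nu).
Proof.
move=> amu anu a b x y a0 b0 ab.
pose p := NngNum a0; pose q := NngNum b0.
have E z : posterior mu z = add_atom mu (p%:num + q%:num)%:nng z.
  by rewrite posteriorE; congr add_atom; apply: val_inj.
have := sp p q x y amu anu; rewrite -!E /= ab mul1r; apply: le_trans.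
apply: mono => //; first exact: admissible_posterior.
  by do 2 apply: admissible_add_atom.
by have := @icx_posterior_split mu p q x y; apply.
Qed.

Lemma updated_value_le mu nu x : admissible mu -> admissible nu ->
  `|updated_value A mu nu x| <= (\sum_(a <- A) `|a|) *
    ((mass mu * abs_mean mu + `|x|) / (mass mu + 1) + abs_mean nu).
Proof.
move=> amu anu; rewrite -abs_mean_posterior//; apply: bd => //.
exact: admissible_posterior.
Qed.

(** Measurability comes from monotonicity, and the bound is affine in |x|. *)
Lemma L1_updated_value rho mu nu : admissible rho ->
  admissible mu -> admissible nu -> L1 rho (updated_value A mu nu).
Proof.
move=> arho amu anu; have m0 := mass_gt0 amu.
apply: (@L1_dominated _ _
  ((\sum_(a <- A) `|a|) * (mass mu * abs_mean mu / (mass mu + 1) + abs_mean nu))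
  ((\sum_(a <- A) `|a|) / (mass mu + 1))) => // [|x].
  by apply: nondecreasing_measurable => // x y; exact: updated_value_homo.
apply: le_trans (updated_value_le x amu anu) _.
by rewrite le_eqVlt; apply/orP; left; apply/eqP; ring.
Qed.

(** The constant does not deteriorate, because the average of the bound on the
    updated value is the bound at the current parameters. *)
Lemma pull_value_le a mu nu : admissible mu -> admissible nu ->
  `|pull_value a A mu nu| <=
  (`|a| + \sum_(b <- A) `|b|) * (abs_mean mu + abs_mean nu).
Proof.
move=> amu anu; have m0 := mass_gt0 amu.
have nu0 := abs_mean_ge0 anu.
set s := \sum_(b <- A) _; rewrite mulrDl; apply: le_trans (ler_normD _ _) _.
apply: lerD.
  rewrite normrM ler_wpM2l//.
  apply: le_trans (le_norm_predictive_mean amu (L1_id amu)) _.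
  by rewrite lerDl.
have hL := L1_updated_value amu amu anu.
apply: le_trans (le_norm_predictive_mean amu hL) _.
pose c := s * (mass mu * abs_mean mu / (mass mu + 1) + abs_mean nu).
have h1 : L1 mu (fun=> 1) by exact: L1_cst.
have h2 : L1 mu (fun x => `|x|) by exact: L1_norm.
apply: (@le_trans _ _ (mean mu (fun x => c * 1 + s / (mass mu + 1) * `|x|))).
  apply: predictive_mean_le => //.
  - exact: integrable_norm hL.
  - exact: L1_lin.
  - move=> x; apply: le_trans (updated_value_le x amu anu) _.
    by rewrite /c -/s le_eqVlt; apply/orP; left; apply/eqP; ring.
rewrite predictive_mean_lin// predictive_mean_cst//.
rewrite -/(abs_mean mu) /c le_eqVlt; apply/orP; left; apply/eqP; field.
by rewrite gt_eqF// addr_gt0.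
Qed.

(** The law of the observation and the posterior both change. The posterior is
    changed first, so that the test function is the one attached to mu'. *)
Lemma pull_value_icx a mu mu' nu : 0 <= a ->
  admissible mu -> admissible mu' -> admissible nu -> icx mu mu' ->
  pull_value a A mu nu <= pull_value a A mu' nu.
Proof.
move=> a0 amu amu' anu h; have M := icx_mass amu amu' h.
have m0 := mass_gt0 amu'.
apply: lerD.
  rewrite ler_wpM2l// /predictive_mean M ler_pM2r ?invr_gt0//.
  by apply: h => //; exact: L1_id.
apply: (@le_trans _ _ (mean mu (updated_value A mu' nu))).
  apply: predictive_mean_le => //; try exact: L1_updated_value.
  move=> x; apply: mono => //; try exact: admissible_posterior.
  exact: icx_posterior.
rewrite /predictive_mean M ler_pM2r ?invr_gt0//.
apply: h; try exact: L1_updated_value.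
- exact: updated_value_homo.
- exact: updated_value_convex.
Qed.

Lemma pull_value_icx_other a mu mu' nu :
  admissible mu -> admissible mu' -> admissible nu -> icx mu mu' ->
  pull_value a A nu mu <= pull_value a A nu mu'.
Proof.
move=> amu amu' anu h; rewrite /pull_value lerD2l.
apply: predictive_mean_le => //; try exact: L1_updated_value.
move=> x; rewrite /updated_value ![value (posterior nu x) _ _]value_sym.
by apply: mono => //; exact: admissible_posterior.
Qed.

(** A second observation equal to the first is worth more, on average, than a
    different one. Both terms on the left split the mass p + 1 over x and y,
    with weights (p, 1) and (1, p); the two bounds of [value_split] add up to
    p + 1 times the right-hand side. *)
Lemma updated_value_swap mu nu p x y : admissible mu -> admissible nu ->
  updated_value A (add_atom mu p y) nu x +
  updated_value A (add_atom mu p x) nu y <=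
  updated_value A (add_atom mu p x) nu x +
  updated_value A (add_atom mu p y) nu y.
Proof.
move=> amu anu; rewrite /updated_value !posteriorE.
set one : {nonneg R} := 1%:nng; rewrite !add_atomD.
have p1 : 0 < p%:num + one%:num :> R by rewrite ltr_wpDl.
rewrite -(ler_pM2l p1) mulrDr.
apply: le_trans (lerD (sp p one y x amu anu) (sp p one x y amu anu)) _.
by rewrite le_eqVlt; apply/orP; left; apply/eqP => /=; ring.
Qed.

(** The observation is drawn from mu, x or y. Bounding the updated value by
    [value_split] in each case produces cross terms p q (Gy x + Gx y), where the
    target has p q (Gx x + Gy y); [updated_value_swap] compares the two. Here Gx
    and Gy are the updated values when the whole mass p + q is put at x,
    respectively at y. *)
Lemma pull_value_split a mu nu p q x y : admissible mu -> admissible nu ->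
  (p%:num + q%:num) * pull_value a A (add_atom (add_atom mu p x) q y) nu <=
  p%:num * pull_value a A (add_atom mu (p%:num + q%:num)%:nng x) nu +
  q%:num * pull_value a A (add_atom mu (p%:num + q%:num)%:nng y) nu.
Proof.
move=> amu anu; have m0 := mass_gt0 amu.
set c : {nonneg R} := (p%:num + q%:num)%:nng.
have sw := updated_value_swap c x y amu anu.
set mxy := add_atom _ q y.
set mx := add_atom mu c x in sw *; set my := add_atom mu c y in sw *.
have amxy : admissible mxy by do 2 apply: admissible_add_atom.
have amx : admissible mx by apply: admissible_add_atom.
have amy : admissible my by apply: admissible_add_atom.
rewrite /pull_value; move: sw.
set Gxy := updated_value A mxy nu; set Gx := updated_value A mx nu.
set Gy := updated_value A my nu => sw.
have G z : (p%:num + q%:num) * Gxy z <= p%:num * Gx z + q%:num * Gy z.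
  rewrite /Gxy /Gx /Gy /updated_value /mxy /mx /my !posterior_add_atom.
  by apply: sp => //; exact: admissible_posterior.
have Lxy : L1 mu Gxy by exact: L1_updated_value.
have Lx : L1 mu Gx by exact: L1_updated_value.
have Ly : L1 mu Gy by exact: L1_updated_value.
have Lid := L1_id amu.
have I : (p%:num + q%:num) * \int[mu]_z Gxy z <=
    p%:num * \int[mu]_z Gx z + q%:num * \int[mu]_z Gy z.
  exact: Rintegral_le_lin.
have E f : L1 mu f ->
    (mean mxy f = (\int[mu]_z f z + p%:num * f x + q%:num * f y) /
       (mass mu + (p%:num + q%:num))) *
    (mean mx f = (\int[mu]_z f z + (p%:num + q%:num) * f x) /
       (mass mu + (p%:num + q%:num))) *
    (mean my f = (\int[mu]_z f z + (p%:num + q%:num) * f y) /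
       (mass mu + (p%:num + q%:num))).
  move=> Lf; have Lf' : L1 (add_atom mu p x) f by apply/L1_add_atom.
  rewrite /predictive_mean !mass_add_atom//; last exact: admissible_add_atom.
  by rewrite !Rintegral_add_atom// addrA.
rewrite !E//.
have Mgt0 : 0 < mass mu + (p%:num + q%:num) by rewrite ltr_pwDl.
have p0 : 0 <= p%:num :> R by []. have q0 : 0 <= q%:num :> R by [].
rewrite -subr_ge0.
(* The difference of the two sides times the total mass: the immediate
   payoffs cancel, and the summands are nonnegative by I, G x, G y and sw. *)
pose D :=
  (p%:num * \int[mu]_z Gx z + q%:num * \int[mu]_z Gy z
    - (p%:num + q%:num) * \int[mu]_z Gxy z)
  + p%:num * (p%:num * Gx x + q%:num * Gy x - (p%:num + q%:num) * Gxy x)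
  + q%:num * (p%:num * Gx y + q%:num * Gy y - (p%:num + q%:num) * Gxy y)
  + p%:num * q%:num * (Gx x + Gy y - (Gy x + Gx y)).
rewrite [leRHS](_ : _ = D / (mass mu + (p%:num + q%:num))); last first.
  by rewrite /D; field; rewrite gt_eqF.
apply: divr_ge0; last exact: ltW.
rewrite /D; apply: addr_ge0; last by rewrite !mulr_ge0// subr_ge0.
by do ![apply: addr_ge0; last by rewrite mulr_ge0// subr_ge0]; rewrite subr_ge0.
Qed.

(** Here the law of the observation is the same in all three terms, so the
    induction hypothesis integrates directly. *)
Lemma pull_value_split_other a mu nu p q x y :
  admissible mu -> admissible nu ->
  (p%:num + q%:num) * pull_value a A nu (add_atom (add_atom mu p x) q y) <=
  p%:num * pull_value a A nu (add_atom mu (p%:num + q%:num)%:nng x) +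
  q%:num * pull_value a A nu (add_atom mu (p%:num + q%:num)%:nng y).
Proof.
move=> amu anu; rewrite /pull_value !mulrDr addrACA -mulrDl lerD2l.
apply: predictive_mean_le_lin => //.
- by apply: L1_updated_value => //; do 2 apply: admissible_add_atom.
- by apply: L1_updated_value => //; apply: admissible_add_atom.
- by apply: L1_updated_value => //; apply: admissible_add_atom.
move=> z; rewrite /updated_value ![value (posterior nu z) _ _]value_sym.
by apply: sp => //; exact: admissible_posterior.
Qed.

End Updated_value.

(** * Conclusion *)

(** None of the three can be proved alone: the bound and the splitting
    inequality integrate the updated value, whose measurability rests on
    monotonicity, and monotonicity rests on its convexity. *)
Lemma value_properties A : (forall a, a \in A -> 0 <= a) ->
  [/\ value_bounded A, value_icx A & value_split A].
Proof.
elim: A => [_|a A IH A0].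
  split=> [mu nu|mu mu' nu|mu nu p q x y] *; rewrite ?big_nil /=.
  - by rewrite normr0 mul0r.
  - exact: lexx.
  - by rewrite !mulr0 addr0.
have a0 : 0 <= a by apply: A0; rewrite mem_head.
have [|bd mono sp] := IH.
  by move=> b bA; apply: A0; rewrite inE bA orbT.
split=> [mu nu amu anu|mu mu' nu amu amu' anu h|mu nu p q x y amu anu].
- rewrite value_cons big_cons /Num.max; case: ifP => _.
    by rewrite [abs_mean _ + _]addrC; exact: pull_value_le.
  exact: pull_value_le.
- rewrite !value_cons ge_max !le_max; apply/andP; split; apply/orP.
    by left; exact: pull_value_icx.
  by right; exact: pull_value_icx_other.
- rewrite !value_cons maxr_pMr// ge_max; apply/andP; split.
    apply: le_trans (pull_value_split _ _ _ _ _ _ _ _ _ _) _ => //.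
    by apply: lerD; rewrite ler_wpM2l// le_max lexx.
  apply: le_trans (pull_value_split_other _ _ _ _ _ _ _ _ _ _) _ => //.
  by apply: lerD; rewrite ler_wpM2l// le_max lexx orbT.
Qed.

Lemma W_value A mu nu : (forall a, a \in A -> 0 <= a) ->
  admissible mu -> admissible nu -> W mu nu A = (value mu nu A)%:E.
Proof.
elim: A mu nu => [//|a A IH] mu nu A0 amu anu.
have {}A0 b : b \in A -> 0 <= b by move=> bA; apply: A0; rewrite inE bA orbT.
have [bd mono sp] := value_properties A0.
rewrite value_cons EFin_max /=; congr (maxe _ _).
- rewrite /pull_value EFinD EFinM /arm_mean.
  rewrite (integral_predictive amu (L1_id amu)); congr (_ + _)%E.
  rewrite -integral_predictive//; last exact: L1_updated_value.
  by apply: eq_integral => x _; rewrite IH//; exact: admissible_posterior.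
- rewrite /pull_value EFinD EFinM /arm_mean.
  rewrite (integral_predictive anu (L1_id anu)); congr (_ + _)%E.
  rewrite -integral_predictive//; last exact: L1_updated_value.
  apply: eq_integral => x _; rewrite IH//; last exact: admissible_posterior.
  by rewrite value_sym.
Qed.

End Bandit.

Theorem theorem1 (R : realType) (n : nat) (n_ge1 : (1 <= n)%N)
    (A : n.-tuple R) (A_discount : discount_sequence A)
    (alpha2 : {finite_measure set (measurableTypeR R) -> \bar R})
    (alpha2_nonnull : alpha2 [set: measurableTypeR R] != 0)
    (alpha2_moment : finite_first_moment alpha2)
    (M : R) (M_gt0 : (0 < M)%R)
    (F F' : probability (measurableTypeR R) R)
    (F_moment : finite_first_moment F)
    (F'_moment : finite_first_moment F')
    (FF' : le_icx F F') :
  W (mscale (NngNum (ltW M_gt0)) F) alpha2 A <=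
  W (mscale (NngNum (ltW M_gt0)) F') alpha2 A.
Proof.
have A0 a : a \in (A : seq R) -> (0 <= a)%R.
  by move=> /tnthP[i ->]; case: A_discount.
have a2 : admissible alpha2.
  split=> //; first by rewrite lt0e alpha2_nonnull measure_ge0.
  by rewrite -ge0_fin_numE// fin_num_measure.
rewrite !W_value//; try exact: admissible_scale.
rewrite lee_fin; have [_ mono _] := value_properties A0.
by apply: mono => //; [exact: admissible_scale..|exact: le_icx_scale].
Qed.
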